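(* Under the correspondence $S\mapsto{\mathcal C}(S)$ between cat-semigroups and categories with biaction, with inverse $C\mapsto(C,\otimes_l,D,R)$, the left restriction semigroups with range correspond exactly to the categories with biaction satisfying (TC3), (TC4L), (TC5a) and additionally $e|f=f|e$ for all $e,f\in C^0$ and $s|e=D(s|e)|s$ for all $s\in C$ and $e\in C^0$. That is: if $S$ is a left restriction semigroup with range then ${\mathcal C}(S)$ is a category with biaction satisfying all these conditions, and the left pseudoproduct on ${\mathcal C}(S)$ is the multiplication of $S$; and conversely, if $C$ is a category with biaction satisfying all these conditions, then the left pseudoproduct $\otimes_l$ is defined on all of $C$, $(C,\otimes_l,D,R)$ is a left restriction semigroup with range, and ${\mathcal C}(C,\otimes_l,D,R)=C$ as categories with biaction.
   Context: Biunary semigroups. A precat-semigroup is a semigroup $S$ with two unary operations $D,R$ such that for all $x\in S$: $D(x)x=x$, $xR(x)=x$, $D(x)^2=D(x)$, $D(R(x))=R(x)$, $R(D(x))=D(x)$. Put $D(S)=\{D(s)\mid s\in S\}$. A cat-semigroup is a precat-semigroup such that for all $x,y$, $R(x)=D(y)$ implies $D(xy)=D(x)$ and $R(xy)=R(y)$. A left restriction semigroup is a semigroup with a unary operation $D$ satisfying $D(x)x=x$, $D(x)D(y)=D(y)D(x)$, $D(D(x)y)=D(x)D(y)$ and $xD(y)=D(xy)x$. A left restriction semigroup with range is a precat-semigroup $(S,\cdot,D,R)$ such that $(S,\cdot,D)$ is a left restriction semigroup and $R(xy)R(y)=R(xy)$ for all $x,y$. (Every such semigroup is a cat-semigroup.)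 Categories. A (small) category is a set $C$ with a partial binary operation $\circ$ and unary operations $D,R$ such that for all $x,y,z\in C$: $D(x)\circ x=x$ and $x\circ R(x)=x$; $R(D(x))=D(x)$ and $D(R(x))=R(x)$; $x\circ y$ exists if and only if $R(x)=D(y)$; if $R(x)=D(y)$ then $D(x\circ y)=D(x)$ and $R(x\circ y)=R(y)$; $x\circ(y\circ z)=(x\circ y)\circ z$ whenever the two products are defined. Its set of identities is $C^0=\{D(s)\mid s\in C\}$. A category with biaction is a category $C$ equipped with everywhere-defined operations $C^0\times C\to C$, $(e,s)\mapsto e|s$ and $C\times C^0\to C$, $(s,e)\mapsto s|e$ such that: (TC1) for $e,f\in C^0$, $e|f$ is the same whether interpreted via the left or the right action; (TC2) $D(a)|a=a$ and $a|R(a)=a$ for all $a\in C$; (TC6) $(e|a)|f=e|(a|f)$ for all $e,f\in C^0$, $a\in C$. Conditions on a category with biaction $C$: (TC3) For all $a\in C$ and $e,f\in C^0$, $e|(f|a)=(e|f)|a$ and $a|(e|f)=(a|e)|f$ (this makes sense since (TC5a) implies $e|f\in C^0$). (TC4a) For all $a,b\in C$, if $a\circ b$ exists then for all $e\in C^0$ so does $(e|a)\circ(R(e|a)|b)$, and $e|(a\circ b)=(e|a)\circ(R(e|a)|b)$. (TC4b$'$) For all $a,b\in C$, if $a\circ b$ exists then for all $e\in C^0$ so does $(a|D(b|e))\circ\big(R(a|D(b|e))|(b|e)\big)$, and it equals $(a\circ b)|e$. (TC4L) means (TC4a) together with (TC4b$'$). (TC5a) For all $e\in C^0$ and $a\in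 C$, $D(e|a)=e|D(a)$. The left pseudoproduct is $s\otimes_l t=(s|D(t))\circ(R(s|D(t))|t)$; it is defined on all of $C$ exactly when $R(s|D(t))=D(R(s|D(t))|t)$ for all $s,t\in C$. For a cat-semigroup $S$, ${\mathcal C}(S)=(S,\circ,D,R)$ where $s\circ t=st$ if $R(s)=D(t)$ and is undefined otherwise; it is a category with ${\mathcal C}(S)^0=D(S)$, and a category with biaction under $e|s=es$, $s|e=se$ for $e\in D(S)$, $s\in S$. *)

(* Defs.v *)
From mathcomp Require Import all_boot.
From mathcomp Require Import boolp.

Set Implicit Arguments.
Unset Strict Implicit.
Unset Printing Implicit Defensive.

Record biunary (T : Type) := Biunary {
  bmul : T -> T -> T;
  bD : T -> T;
  bR : T -> T
}.

Section Semigroups.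
Variables (T : Type) (S : biunary T).
Local Notation "x * y" := (bmul S x y).
Local Notation D := (bD S).
Local Notation R := (bR S).

Record precat_semigroup : Prop := {
  precat_assoc : associative (bmul S);
  precat_Dmul : forall x, D x * x = x;
  precat_mulR : forall x, x * R x = x;
  precat_Didem : forall x, D x * D x = D x;
  precat_DR : forall x, D (R x) = R x;
  precat_RD : forall x, R (D x) = D x
}.

Record cat_semigroup : Prop := {
  cat_precat : precat_semigroup;
  cat_D : forall x y, R x = D y -> D (x * y) = D x;
  cat_R : forall x y, R x = D y -> R (x * y) = R y
}.

Record left_restriction_semigroup : Prop := {
  lrestr_assoc : associative (bmul S);
  lrestr_Dmul : forall x, D x * x = x;
  lrestr_DC : forall x y, D x * D y = D y * D x;
  lrestr_DDmul : forall x y, D (D x * y) = D x * D y;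
  lrestr_ample : forall x y, x * D y = D (x * y) * x
}.

Record left_restriction_semigroup_with_range : Prop := {
  lrr_precat : precat_semigroup;
  lrr_lrestr : left_restriction_semigroup;
  lrr_range : forall x y, R (x * y) * R y = R (x * y)
}.

End Semigroups.

(* The set {D s | s in T}; for a category this is its set C^0 of identities. *)
Definition D_image (T : Type) (D : T -> T) := {e : T | exists s, e = D s}.

(* Operations of a category with biaction, without axioms.  The composite is
   partial: [comp x y = None] when x o y is undefined.  The actions are
   everywhere defined on C^0 x C and on C x C^0. *)
Record biact (T : Type) := Biact {
  comp : T -> T -> option T;
  dom : T -> T;
  ran : T -> T;
  lact : D_image dom -> T -> T;
  ract : T -> D_image dom -> T
}.

Section Categories.
Variables (T : Type) (C : biact T).
Local Notation D := (dom C).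
Local Notation R := (ran C).
Local Notation C0 := (D_image (dom C)).
Local Notation "x 'o' y" := (comp C x y) (at level 40).
Local Notation "e >| s" := (lact e s) (at level 35, right associativity).
Local Notation "s |< e" := (ract s e) (at level 35, right associativity).

(* D x as an element of C^0. *)
Definition domI (x : T) : C0 := exist _ (D x) (ex_intro _ x (erefl (D x))).

(* R x as an element of C^0: in a category the underlying element D (R x) is
   R x; going through D provides the membership proof. *)
Definition ranI (x : T) : C0 := domI (R x).

Record category : Prop := {
  cat_Dcomp : forall x, D x o x = Some x;
  cat_compR : forall x, x o R x = Some x;
  cat_RD : forall x, R (D x) = D x;
  cat_DR : forall x, D (R x) = R x;
  cat_exists : forall x y, (exists z, x o y = Some z) <-> R x = D y;
  cat_dom_comp : forall x y z, R x = D y -> x o y = Some z -> D z = D x;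
  cat_ran_comp : forall x y z, R x = D y -> x o y = Some z -> R z = R y;
  cat_assoc : forall x y z xy yz l r,
    y o z = Some yz -> x o yz = Some l ->
    x o y = Some xy -> xy o z = Some r -> l = r
}.

Definition TC1 := forall e f : C0, e >| sval f = sval e |< f.

Definition TC2 := forall a : T, domI a >| a = a /\ a |< ranI a = a.

Definition TC6 := forall (e f : C0) (a : T), (e >| a) |< f = e >| (a |< f).

Record category_with_biaction : Prop := {
  cwb_category : category;
  cwb_TC1 : TC1;
  cwb_TC2 : TC2;
  cwb_TC6 : TC6
}.

(* g is e | f as an element of C^0; it exists as soon as TC5a holds, since
   then D (e | f) = e | D f = e | f. *)
Definition TC3 := forall e f : C0, exists2 g : C0, sval g = e >| sval f &
  forall a : T, e >| (f >| a) = g >| a /\ a |< g = (a |< e) |< f.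

Definition TC4a := forall a b ab : T, a o b = Some ab ->
  forall e : C0, (e >| a) o (ranI (e >| a) >| b) = Some (e >| ab).

Definition TC4b' := forall a b ab : T, a o b = Some ab ->
  forall e : C0,
    (a |< domI (b |< e)) o (ranI (a |< domI (b |< e)) >| (b |< e))
    = Some (ab |< e).

Definition TC4L := TC4a /\ TC4b'.

Definition TC5a := forall (e : C0) (a : T), D (e >| a) = e >| D a.

Definition lpseudo (s t : T) : option T :=
  (s |< domI t) o (ranI (s |< domI t) >| t).

Record left_restriction_conditions : Prop := {
  lrc_TC3 : TC3;
  lrc_TC4L : TC4L;
  lrc_TC5a : TC5a;
  lrc_comm : forall e f : C0, e >| sval f = f >| sval e;
  lrc_ample : forall (s : T) (e : C0), s |< e = domI (s |< e) >| s
}.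

End Categories.

Definition cat_of (T : Type) (S : biunary T) : biact T :=
  @Biact T
    (fun s t => if `[< bR S s = bD S t >] then Some (bmul S s t) else None)
    (bD S) (bR S)
    (fun e s => bmul S (sval e) s)
    (fun s e => bmul S s (sval e)).

(* Main.v *)
Require Import Defs.
From mathcomp Require Import all_boot.
From mathcomp Require Import boolp.

Set Implicit Arguments.
Unset Strict Implicit.
Unset Printing Implicit Defensive.

(** Both directions rest on how ranges behave under restriction: writing
    [f <= g] for [f g = f], one has [R (s y) <= R y], and in particular
    [R (s e) <= e] when [e] is an identity.

    In a left restriction semigroup with range the first inequality is an
    axiom, and the second makes [R x] the least right identity of [x] among
    the projections ([ran_least]).  Minimality gives the law [R (x y) = R y]
    for composable [x], [y], so the semigroup is a cat-semigroup.  The two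
    inequalities also make every composite appearing in TC4a, TC4b' and the
    left pseudoproduct defined ([mul_via_ran]).

    In a category with biaction both inequalities come from the trivial
    factorisation [s o R s = s]: TC4a gives [R (e | s) <= R s]
    ([ran_lact_absorb]) and TC4b' gives [R (s | e) <= e]
    ([ran_ract_absorb]).  Since the range of [s | D t] lies below [D t], the
    pseudoproduct is total.  Writing [*] for it, it extends
    both actions and the composition.  Associativity follows from three rules:
    [(e | s) * t = e | (s * t)], the balancing rule
    [(s | e) * t = s * (e | t)], and associativity when the first two factors
    are composable.  With [c = s | D t], so that [s * t = c o (R c | t)], they
    give
      [(s * t) * u = c * (R c | (t * u)) = c * (t * u)
                   = s * (D t | (t * u)) = s * (t * u)]. *)

(** * From semigroups to categories *)

Section SemigroupToCategory.
Variables (T : Type) (S : biunary T).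
Hypothesis HS : left_restriction_semigroup_with_range S.

Local Notation "x * y" := (bmul S x y).
Local Notation D := (bD S).
Local Notation R := (bR S).

Let mulA : associative (bmul S) := precat_assoc (lrr_precat HS).
Let Dmul x : D x * x = x := precat_Dmul (lrr_precat HS) x.
Let mulR x : x * R x = x := precat_mulR (lrr_precat HS) x.
Let DR x : D (R x) = R x := precat_DR (lrr_precat HS) x.
Let RD x : R (D x) = D x := precat_RD (lrr_precat HS) x.
Let DC x y : D x * D y = D y * D x := lrestr_DC (lrr_lrestr HS) x y.
Let DDmul x y : D (D x * y) = D x * D y := lrestr_DDmul (lrr_lrestr HS) x y.
Let ample x y : x * D y = D (x * y) * x := lrestr_ample (lrr_lrestr HS) x y.
Let ran_mul x y : R (x * y) * R y = R (x * y) := lrr_range HS x y.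

(** By ampleness [x D(y) = D(xy) x], whose domain is
    [D(xy) D(x) = D(D(x) xy) = D(xy)]. *)
Lemma bD_mulD x y : D (x * D y) = D (x * y).
Proof. by rewrite ample DDmul DC -DDmul mulA Dmul. Qed.

Lemma ran_absorb_mulD x y : R (x * D y) * D y = R (x * D y).
Proof. by rewrite -{2}RD ran_mul. Qed.

Lemma ran_least x y : x * D y = x -> R x * D y = R x.
Proof. by move=> <-; apply: ran_absorb_mulD. Qed.

Lemma bD_comp x y : R x = D y -> D (x * y) = D x.
Proof. by move=> Rxy; rewrite -bD_mulD -Rxy mulR. Qed.

(** [R y <= R (x y)] by minimality of [R y]: with [e = R (x y)], the equality
    [x y e = x y] makes [D (y e)] a right identity of [x], so
    [D y = R x <= D (y e)], and hence [y e = D (y e) y = y]. *)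
Lemma bR_comp x y : R x = D y -> R (x * y) = R y.
Proof.
move=> Rxy; set e := R (x * y).
have De : D e = e by rewrite DR.
have xye : x * (y * e) = x * y by rewrite mulA mulR.
have xD : x * D (y * e) = x by rewrite ample xye bD_comp // Dmul.
have DyD : D y * D (y * e) = D y by rewrite -Rxy; apply: ran_least.
have ye : y * D e = y.
  by rewrite ample -{2}(Dmul y) mulA DC DyD Dmul.
by rewrite -[RHS](ran_least ye) -(DR y) DC De DR ran_mul.
Qed.

Lemma lrr_cat_semigroup : cat_semigroup S.
Proof. by split; [apply: lrr_precat HS | apply: bD_comp | apply: bR_comp]. Qed.

Lemma comp_cat_of x y z :
  Defs.comp (cat_of S) x y = Some z <-> R x = D y /\ z = x * y.
Proof.
rewrite /=; case: asboolP => Rxy; split=> [|[]] //.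
- by case=> ->.
- by move=> _ ->.
Qed.

Lemma cat_of_category : category (cat_of S).
Proof.
split.
- by move=> x; apply/comp_cat_of; rewrite RD Dmul.
- by move=> x; apply/comp_cat_of; rewrite /= DR mulR.
- exact: RD.
- exact: DR.
- move=> x y; split=> [[z /comp_cat_of[]] // | Rxy].
  by exists (x * y); apply/comp_cat_of.
- by move=> x y z Rxy /comp_cat_of[_ ->]; apply: bD_comp.
- by move=> x y z Rxy /comp_cat_of[_ ->]; apply: bR_comp.
- move=> x y z xy yz l r /comp_cat_of[_ ->] /comp_cat_of[_ ->].
  by move=> /comp_cat_of[_ ->] /comp_cat_of[_ ->].
Qed.

Lemma cat_of_biaction : category_with_biaction (cat_of S).
Proof.
split; first exact: cat_of_category.
- by move=> e f.
- by move=> a /=; rewrite Dmul DR mulR.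
- by move=> e f a; rewrite /= mulA.
Qed.

(** If the range of [x] absorbs [D y] then [x] composes with [R x | y], and
    inserting [R x] does not change the product. *)
Lemma mul_via_ran x y : R x * D y = R x ->
  Defs.comp (cat_of S) x (lact (ranI (cat_of S) x) y) = Some (x * y).
Proof.
move=> RxDy; apply/comp_cat_of; rewrite /= DR mulA mulR; split=> //.
by rewrite -[in RHS]DR DDmul DR.
Qed.

Lemma lpseudo_cat_of s t : lpseudo (cat_of S) s t = Some (s * t).
Proof.
by rewrite /lpseudo mul_via_ran /= ?ran_absorb_mulD // -mulA Dmul.
Qed.

Lemma cat_of_conditions : left_restriction_conditions (cat_of S).
Proof.
split.
- move=> e f.
  have Def : exists s, sval e * sval f = D s.
    case: e f => [e [x eE]] [f [y fE]]; exists (D x * y).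
    by rewrite /= DDmul eE fE.
  by exists (exist (fun x => exists s, x = D s) _ Def) => //= a; rewrite !mulA.
- split=> a b _ /comp_cat_of[Rab ->] e.
  + rewrite mul_via_ran /= -?mulA //.
    by rewrite -Rab ran_mul.
  + (* this composite is the left pseudoproduct of a and b | e *)
    by rewrite -/(lpseudo (cat_of S) a _) lpseudo_cat_of /= mulA.
- by case=> e [x eE] a; rewrite /= eE DDmul.
- by move=> [e [x eE]] [f [y fE]]; rewrite /= eE fE DC.
- by move=> s [e [y eE]]; rewrite /= eE bD_mulD ample.
Qed.

End SemigroupToCategory.

(** * From categories to semigroups *)

Section CategoryToSemigroup.
Variables (T : Type) (C : biact T).
Hypothesis HC : category_with_biaction C.
Hypothesis HL : left_restriction_conditions C.

Local Notation D := (dom C).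
Local Notation R := (ran C).
Local Notation C0 := (D_image (dom C)).
Local Notation "x 'o' y" := (Defs.comp C x y) (at level 40).
Local Notation "e >| s" := (lact e s) (at level 35, right associativity).
Local Notation "s |< e" := (ract s e) (at level 35, right associativity).
Local Notation domI := (domI C).
Local Notation ranI := (ranI C).

Let HK := cwb_category HC.
Let RD x : R (D x) = D x := cat_RD HK x.
Let DR x : D (R x) = R x := cat_DR HK x.
Let actlrA e f a : (e >| a) |< f = e >| (a |< f) := cwb_TC6 HC e f a.
Let dom_lact e a : D (e >| a) = e >| D a := lrc_TC5a HL e a.
Let TC4aE a b ab := (lrc_TC4L HL).1 a b ab.
Let TC4bE a b ab := (lrc_TC4L HL).2 a b ab.

Lemma C0_inj (e f : C0) : sval e = sval f -> e = f.
Proof. by case: e f => [x px] [y py] /= xy; apply: eq_exist. Qed.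

Lemma dom_C0 (e : C0) : D (sval e) = sval e.
Proof. by case: e => e [x eE] /=; rewrite eE -{1}(RD x) DR RD. Qed.

Lemma ran_C0 (e : C0) : R (sval e) = sval e.
Proof. by rewrite -dom_C0 RD. Qed.

Lemma domI_C0 (e : C0) : domI (sval e) = e.
Proof. by apply: C0_inj; rewrite /= dom_C0. Qed.

Lemma sval_ranI x : sval (ranI x) = R x.
Proof. exact: DR. Qed.

Lemma comp_composable x y z : x o y = Some z -> R x = D y.
Proof. by move=> xyz; apply/(cat_exists HK); exists z. Qed.

Lemma comp_dom x y z : x o y = Some z -> D z = D x.
Proof. by move=> xyz; apply: (cat_dom_comp HK (comp_composable xyz) xyz). Qed.

Lemma comp_ran x y z : x o y = Some z -> R z = R y.
Proof. by move=> xyz; apply: (cat_ran_comp HK (comp_composable xyz) xyz). Qed.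

Lemma lact_dom a : domI a >| a = a.
Proof. by case: (cwb_TC2 HC a). Qed.

Lemma ract_ran a : a |< ranI a = a.
Proof. by case: (cwb_TC2 HC a). Qed.

(** The product [e | f] of two identities, as an identity. *)
Definition meetI (e f : C0) : C0 := domI (e >| sval f).

Lemma sval_meetI (e f : C0) : sval (meetI e f) = e >| sval f.
Proof. by rewrite /= dom_lact dom_C0. Qed.

Lemma lactA (e f : C0) a : e >| (f >| a) = meetI e f >| a.
Proof.
have [g gE gA] := lrc_TC3 HL e f.
have -> : meetI e f = g by apply: C0_inj; rewrite sval_meetI gE.
by case: (gA a).
Qed.

Lemma ractA (e f : C0) a : (a |< e) |< f = a |< meetI e f.
Proof.
have [g gE gA] := lrc_TC3 HL e f.
have -> : meetI e f = g by apply: C0_inj; rewrite sval_meetI gE.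
by case: (gA a).
Qed.

Lemma meetIC e f : meetI e f = meetI f e.
Proof. by apply: C0_inj; rewrite !sval_meetI; apply: lrc_comm HL e f. Qed.

Lemma meetII e : meetI e e = e.
Proof.
by apply: C0_inj; rewrite sval_meetI -{1}(domI_C0 e) lact_dom.
Qed.

Lemma meetIA e f g : meetI e (meetI f g) = meetI (meetI e f) g.
Proof. by apply: C0_inj; rewrite !sval_meetI lactA. Qed.

Lemma domI_lact (e : C0) a : domI (e >| a) = meetI e (domI a).
Proof. by apply: C0_inj; rewrite sval_meetI /= dom_lact. Qed.

(** TC4a for [a o R a = a] says that [e | a] composes with
    [R (e | a) | R a]. *)
Lemma ran_lact_absorb (e : C0) a :
  meetI (ranI (e >| a)) (ranI a) = ranI (e >| a).
Proof.
apply: C0_inj; rewrite sval_meetI !sval_ranI.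
have /comp_composable -> := TC4aE (cat_compR HK a) e.
by rewrite dom_lact DR.
Qed.

(** TC4b' for [a o R a = a] exhibits [a | e] as a composite [a' o r], where
    [a' = a | (R a | e)].  As [r] is an identity, [a | e = a'], and
    composability gives [R a' = R a' | (R a | e)]. *)
Lemma ran_ract_meet (e : C0) a :
  meetI (ranI (a |< e)) (meetI (ranI a) e) = ranI (a |< e).
Proof.
have Rae : R a |< e = sval (meetI (ranI a) e).
  by rewrite sval_meetI (cwb_TC1 HC) sval_ranI.
have := TC4bE (cat_compR HK a) e.
rewrite Rae domI_C0; set a' := a |< meetI _ _.
rewrite -sval_meetI => a'r.
have rE : sval (meetI (ranI a') (meetI (ranI a) e)) = R a'.
  by rewrite (comp_composable a'r) dom_C0.
have a'E : a' = a |< e.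
  by move: a'r; rewrite rE (cat_compR HK) => -[].
by apply: C0_inj; rewrite -a'E rE sval_ranI.
Qed.

Lemma ran_ract_absorb (e : C0) a : meetI (ranI (a |< e)) e = ranI (a |< e).
Proof. by rewrite -ran_ract_meet -!meetIA meetII. Qed.

Lemma lpseudo_total s t : exists z, lpseudo C s t = Some z.
Proof.
apply/(cat_exists HK).
rewrite dom_lact -[D t]/(sval (domI t)) -sval_meetI ran_ract_absorb.
by rewrite sval_ranI.
Qed.

(** The default value is never taken, by [lpseudo_total]. *)
Definition lmul s t : T := odflt s (lpseudo C s t).

Local Notation "s * t" := (lmul s t).

Lemma lpseudoE s t : lpseudo C s t = Some (s * t).
Proof. by rewrite /lmul; have [z ->] := lpseudo_total s t. Qed.

Lemma lmulP s t z :
  (s |< domI t) o (ranI (s |< domI t) >| t) = Some z -> s * t = z.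
Proof. by rewrite -/(lpseudo C s t) lpseudoE => -[]. Qed.

Lemma dom_lmul s t : D (s * t) = D (s |< domI t).
Proof. exact: comp_dom (lpseudoE s t). Qed.

Lemma ran_lmul s t : R (s * t) = R (ranI (s |< domI t) >| t).
Proof. exact: comp_ran (lpseudoE s t). Qed.

Lemma lmul_ract s (e : C0) : s * sval e = s |< e.
Proof.
apply: lmulP; rewrite domI_C0 -sval_meetI ran_ract_absorb sval_ranI.
exact: cat_compR.
Qed.

Lemma lmul_lact (e : C0) t : sval e * t = e >| t.
Proof.
apply: lmulP.
rewrite -(cwb_TC1 HC) -sval_meetI.
have -> : ranI (sval (meetI e (domI t))) = meetI e (domI t).
  by apply: C0_inj; rewrite sval_ranI ran_C0.
rewrite -lactA lact_dom -domI_lact.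
exact: cat_Dcomp.
Qed.

Lemma lmul_comp s t z : s o t = Some z -> s * t = z.
Proof.
move=> stz; have Rst := comp_composable stz; apply: lmulP.
have -> : domI t = ranI s by apply: C0_inj; rewrite sval_ranI.
rewrite ract_ran.
have -> : ranI s = domI t by apply: C0_inj; rewrite sval_ranI.
by rewrite lact_dom.
Qed.

(** TC4a applied to the composite that defines [s * t]. *)
Lemma lact_lmul (e : C0) s t : (e >| s) * t = e >| (s * t).
Proof.
apply: lmulP; rewrite actlrA.
have := TC4aE (lpseudoE s t) e.
by rewrite lactA ran_lact_absorb.
Qed.

(** Both sides have left factor [c = (s | e) | D t]; as identities commute,
    [c] is also a restriction by [e], so [R c] absorbs the [e] in front of
    [t]. *)
Lemma lmul_balanced s (e : C0) t : (s |< e) * t = s * (e >| t).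
Proof.
apply: esym; apply: lmulP; rewrite domI_lact lactA.
rewrite (meetIC e) -ractA ran_ract_absorb ractA -(meetIC e) -ractA.
exact: lpseudoE.
Qed.

(** By TC4b', [(x o y) | D u = d o (R d | c)] with [c = y | D u] and
    [d = x | D c]; by TC4a, [R d | (y * u)] starts with the same factor
    [R d | c].  Associativity of composition compares the two triples. *)
Lemma lmul_comp_assoc x y xy u : x o y = Some xy -> xy * u = x * (y * u).
Proof.
move=> xyE; apply: esym; apply: lmulP.
have -> : domI (y * u) = domI (y |< domI u).
  by apply: C0_inj; rewrite /= dom_lmul.
have dE := TC4bE xyE (domI u).
set c := y |< domI u in dE *; set d := x |< domI c in dE *.
have := TC4aE (lpseudoE y u) (ranI d).
rewrite -/c lactA ran_lact_absorb => rE.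
have [l lE] : exists l, d o (ranI d >| (y * u)) = Some l.
  apply/(cat_exists HK).
  by rewrite (comp_composable dE) (comp_dom rE).
have ranE : ranI (xy |< domI u) = ranI (ranI d >| c).
  by apply: C0_inj; rewrite !sval_ranI (comp_ran dE).
have := lpseudoE xy u; rewrite /lpseudo ranE => rhs.
by rewrite lE (cat_assoc HK rE lE dE rhs).
Qed.

Lemma lmulA : associative lmul.
Proof.
move=> s t u.
rewrite (lmul_comp_assoc u (lpseudoE s t)) lact_lmul -lmul_balanced.
by rewrite ract_ran lmul_balanced -lact_lmul lact_dom.
Qed.

Lemma lmul_lrr : left_restriction_semigroup_with_range (Biunary lmul D R).
Proof.
have Dmul x : D x * x = x by rewrite (lmul_lact (domI x)) lact_dom.
split=> /=.
- split=> //=; first exact: lmulA.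
  + by move=> x; rewrite -sval_ranI lmul_ract ract_ran.
  + move=> x; rewrite (lmul_lact (domI x)) -[D x]/(sval (domI x)).
    by rewrite -sval_meetI meetII.
- split=> //=; first exact: lmulA.
  + move=> x y; rewrite (lmul_lact (domI x)) (lmul_lact (domI y)).
    exact: (lrc_comm HL (domI x) (domI y)).
  + by move=> x y; rewrite !(lmul_lact (domI x)) dom_lact.
  + move=> x y; rewrite dom_lmul (lmul_ract x (domI y)).
    by rewrite (lmul_lact (domI _)); apply: lrc_ample HL x (domI y).
- move=> x y /=; rewrite ran_lmul -!sval_ranI lmul_lact -sval_meetI.
  by rewrite ran_lact_absorb.
Qed.

Lemma cat_of_lmul : cat_of (Biunary lmul D R) = C.
Proof.
have compE s t :
    (if `[< R s = D t >] then Some (s * t) else None) = s o t.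
  case: asboolP => [/(cat_exists HK)[z stz] | nRst].
    by rewrite stz (lmul_comp stz).
  by case stz: (s o t) => [z|] //; case: nRst; apply: comp_composable stz.
have lactE (e : C0) s : sval e * s = e >| s by apply: lmul_lact.
have ractE s (e : C0) : s * sval e = s |< e by apply: lmul_ract.
rewrite /cat_of /=.
case: (C) (lmul) compE lactE ractE => c d r la ra m /= compE lactE ractE.
f_equal; apply/funext => x; apply/funext => y.
- exact: compE.
- exact: lactE.
- exact: ractE.
Qed.

End CategoryToSemigroup.

Theorem corollary4p12 :
  (forall (T : Type) (S : biunary T),
     left_restriction_semigroup_with_range S ->
     [/\ cat_semigroup S,
         category_with_biaction (cat_of S),
         left_restriction_conditions (cat_of S) &
         forall s t : T, lpseudo (cat_of S) s t = Some (bmul S s t)])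
  /\
  (forall (T : Type) (C : biact T),
     category_with_biaction C ->
     left_restriction_conditions C ->
     exists mul : T -> T -> T,
       let S := Biunary mul (dom C) (ran C) in
       [/\ forall s t : T, lpseudo C s t = Some (mul s t),
           left_restriction_semigroup_with_range S &
           cat_of S = C]).
Proof.
split=> [T S HS | T C HC HL].
  split; [exact: lrr_cat_semigroup | exact: cat_of_biaction
         | exact: cat_of_conditions | exact: lpseudo_cat_of].
exists (lmul C); split.
- exact: lpseudoE.
- exact: lmul_lrr.
- exact: cat_of_lmul.
Qed.
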